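(* Let $\varphi:\mathbb{R}^{2n}\to\mathbb{R}$ be a continuous and proper convex function, let $F(\cdot,t):\mathbb{R}^n\times\mathbb{R}^n\rightrightarrows\mathbb{R}^n$, $t\in[0,1]$, be convex set-valued mappings, and let $Q_0,Q_1\subseteq\mathbb{R}^n$ be nonempty convex sets. Consider the problem $(P_C)$: minimize $\varphi(x(1),x'(1))$ over feasible trajectories $x(\cdot)$, i.e. functions $x:[0,1]\to\mathbb{R}^n$ absolutely continuous together with $x'$, with $x''\in L_1^n([0,1])$, satisfying $$x''(t)\in F(x(t),x'(t),t)\ \text{ for a.e. } t\in[0,1],\qquad x(0)\in Q_0,\quad x'(0)\in Q_1.$$ Then for optimality of the feasible trajectory $\tilde x(\cdot)$ in $(P_C)$ it is sufficient that there exists a pair of absolutely continuous functions $\{x^*(t),v^*(t)\}$, $t\in[0,1]$, such that (a) $\big(x^{*\prime\prime}(t)+v^{*\prime}(t),\ v^*(t)\big)\in F^*\big(x^*(t);(\tilde x(t),\tilde x'(t),\tilde x''(t)),t\big)$ for a.e. $t\in[0,1]$; (b) $\tilde x''(t)\in F_A(\tilde x(t),\tilde x'(t);x^*(t),t)$ for a.e. $t\in[0,1]$; (c) $\big(v^*(0)+x^{*\prime}(0),\ -x^*(0)\big)\in K^*_{Q_0}(\tilde x(0))\times K^*_{Q_1}(\tilde x'(0))$; (d) $\big(v^*(1)+x^{*\prime}(1),\ -x^*(1)\big)\in\partial_{(x,y)}\varphi(\tilde x(1),\tilde x'(1))$.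
   Context: Here $x^*(\cdot)$ is absolutely continuous together with its first derivative with $x^{*\prime\prime}\in L_1^n([0,1])$, and $v^*(\cdot)$ is absolutely continuous with $v^{*\prime}\in L_1^n([0,1])$. For a set-valued mapping $G:\mathbb{R}^{2n}\rightrightarrows\mathbb{R}^n$: $\mathrm{gph}\,G=\{(x,y,z):z\in G(x,y)\}$; $G$ is convex if $\mathrm{gph}\,G$ is convex. Hamiltonian function: $H_G(x,y,z^* )=\sup\{\langle z,z^*\rangle:z\in G(x,y)\}$ (equal to $-\infty$ if $G(x,y)=\varnothing$). Argmaximum set: $G_A(x,y,z^* )=\{z\in G(x,y):\langle z,z^*\rangle=H_G(x,y,z^* )\}$. Locally adjoint mapping: for $(x,y,z)\in\mathrm{gph}\,G$ with $z\in G_A(x,y,z^* )$, $$G^*(z^*;(x,y,z))=\{(x^*,y^* ):H_G(x_1,y_1,z^* )-H_G(x,y,z^* )\le\langle x^*,x_1-x\rangle+\langle y^*,y_1-y\rangle\ \ \forall(x_1,y_1)\in\mathbb{R}^{2n}\};$$ for convex $G$ this coincides with $\{(x^*,y^* ):(x^*,y^*,-z^* )\in K^*_{\mathrm{gph}\,G}(x,y,z)\}$. $F^*(\cdot\,;\cdot,t)$ and $F_A(\cdot,\cdot;\cdot,t)$ denote these objects for $G=F(\cdot,t)$. For a convex set $A$ and $w_0\in A$, $K_A(w_0)$ is the convex cone of tangent directions, i.e. of vectors $\bar w$ for which there is a function $\eta$ with $w_0+\lambda\bar w+\eta(\lambda)\in A$ for small $\lambda>0$ and $\lambda^{-1}\eta(\lambda)\to0$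 as $\lambda\downarrow0$; $K_A^*(w_0)=\{w^*:\langle\bar w,w^*\rangle\ge0\ \forall\bar w\in K_A(w_0)\}$ (for convex $A$ this equals $\{w^*:\langle w-w_0,w^*\rangle\ge0\ \forall w\in A\}$). $\partial_{(x,y)}\varphi$ is the subdifferential of convex analysis. *)

(* Defs.v *)
From HB Require Import structures.
From mathcomp Require Import all_boot all_order all_algebra.
From mathcomp Require Import all_classical all_reals all_analysis.

Set Implicit Arguments.
Unset Strict Implicit.
Unset Printing Implicit Defensive.

Import Order.TTheory GRing.Theory Num.Theory.
Import numFieldNormedType.Exports.

Local Open Scope classical_set_scope.
Local Open Scope ring_scope.

Section euclidean.
Context {R : realType} {n : nat}.
Local Notation V := 'rV[R]_n.

Definition dot (u v : V) : R := \sum_(i < n) u ord0 i * v ord0 i.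

Section setvalued.
Variable G : V -> V -> set V.

Definition gph : set (V * V * V) := [set w | G w.1.1 w.1.2 w.2].

Definition convex_map : Prop := @convex_set R (V * V * V)%type gph.

(* ereal_sup set0 = -oo, so this is -oo exactly when G x y is empty. *)
Definition hamiltonian (x y zs : V) : \bar R :=
  ereal_sup [set (dot z zs)%:E | z in G x y].

Definition argmax (x y zs : V) : set V :=
  [set z | G x y z /\ (dot z zs)%:E = hamiltonian x y zs].

(* Meaningful at points w = (x, y, z) of the graph with z in argmax x y zs;
   there hamiltonian x y zs is finite, so the subtraction in \bar R is never
   an indeterminate form. *)
Definition locally_adjoint (zs : V) (w : V * V * V) : set (V * V) :=
  [set p | forall x1 y1 : V,
    (hamiltonian x1 y1 zs - hamiltonian w.1.1 w.1.2 zs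
       <= (dot p.1 (x1 - w.1.1) + dot p.2 (y1 - w.1.2))%:E)%E].

End setvalued.

Definition tangent_cone (A : set V) (w0 : V) : set V :=
  [set w | exists eta : R -> V,
    (\forall l \near 0^'+, A (w0 + l *: w + eta l)) /\
    (l^-1 *: eta l @[l --> 0^'+] --> (0 : V))].

Definition dual_cone (A : set V) (w0 : V) : set V :=
  [set ws | forall w, tangent_cone A w0 w -> 0 <= dot w ws].

Definition subdifferential (phi : V * V -> R) (p : V * V) : set (V * V) :=
  [set q | forall p1 : V * V,
    dot q.1 (p1.1 - p.1) + dot q.2 (p1.2 - p.2) <= phi p1 - phi p].

(* A function on [0, 1] is represented by a function on R, of which only the
   restriction to [0, 1] matters; der is thus the derivative relative to
   [0, 1], i.e. the one-sided derivative at 0 and at 1. *)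
Definition diff_quot (f : R -> V) (t : R) : set_system V :=
  (s - t)^-1 *: (f s - f t) @[s --> within `[0, 1] t^'].

Definition der (f : R -> V) (t : R) : V := lim (diff_quot f t).

Definition abs_cont (f : R -> V) : Prop :=
  forall e : R, 0 < e -> exists2 d : R, 0 < d &
    forall (m : nat) (l r : 'I_m -> R),
      (forall i, 0 <= l i /\ l i <= r i /\ r i <= 1) ->
      trivIset [set: 'I_m] (fun i => `]l i, r i[%classic) ->
      \sum_(i < m) (r i - l i) < d ->
      \sum_(i < m) `|f (r i) - f (l i)| < e.

Definition L1 (g : R -> V) : Prop :=
  forall i : 'I_n,
    (@lebesgue_measure R).-integrable `[0, 1] (fun t => (g t ord0 i)%:E).

(* The derivative of f is a class in L_1: as der f t is a default value where
   f is not differentiable, existence almost everywhere is made explicit. *)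
Definition derivative_L1 (f : R -> V) : Prop :=
  (\forall t \ae @lebesgue_measure R, t \in `[0, 1] -> cvg (diff_quot f t)) /\
  L1 (der f).

Definition AC_L1 (f : R -> V) : Prop := abs_cont f /\ derivative_L1 f.

Definition AC2_L1 (f : R -> V) : Prop :=
  [/\ abs_cont f,
      (forall t, t \in `[0, 1] -> cvg (diff_quot f t)) &
      AC_L1 (der f)].

Definition feasible (F : R -> V -> V -> set V) (Q0 Q1 : set V) (x : R -> V) :
    Prop :=
  [/\ AC2_L1 x,
      (\forall t \ae @lebesgue_measure R, t \in `[0, 1] ->
         F t (x t) (der x t) (der (der x) t)),
      Q0 (x 0) &
      Q1 (der x 0)].

Definition optimal (phi : V * V -> R) (F : R -> V -> V -> set V)
    (Q0 Q1 : set V) (x : R -> V) : Prop :=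
  feasible F Q0 Q1 x /\
  forall y, feasible F Q0 Q1 y -> phi (x 1, der x 1) <= phi (y 1, der y 1).

End euclidean.

(* Main.v *)
Require Import Defs.
From HB Require Import structures.
From mathcomp Require Import all_boot all_order all_algebra.
From mathcomp Require Import all_classical all_reals all_analysis.
From mathcomp Require Import ring lra.

Set Implicit Arguments.
Unset Strict Implicit.
Unset Printing Implicit Defensive.

Import Order.TTheory GRing.Theory Num.Theory.
Import numFieldNormedType.Exports.

Local Open Scope classical_set_scope.
Local Open Scope ring_scope.

(** Fix a feasible [y] and let [d = y - xt].  The adjoint inclusion bounds the
    increment of the Hamiltonian between [(xt, xt')] and [(y, y')] from above;
    as [y''] competes in the supremum defining the Hamiltonian at [(y, y')] and
    [xt''] attains the one at [(xt, xt')], almost everywhere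
      [<y'' - xt'', xs> <= <xs'' + vs', d> + <vs, d'>].
    After the terms [<xs', d'>] cancel, this says that
      [h = <vs + xs', d> - <xs, d'>]
    has a nonnegative derivative almost everywhere (see
    [pairing_nondecreasing]).  Since [h] is a sum of products of
    absolutely continuous functions, [h 0 <= h 1].  The subgradient condition
    at time 1 says [h 1 <= phi (y 1, y' 1) - phi (xt 1, xt' 1)], and the
    transversality conditions at time 0 say [0 <= h 0], because in a convex set
    the direction towards any other point of the set is tangent.

    The analytic core is [abs_contR_nonincreasing]: an absolutely continuous
    function whose derivative is a.e. nonpositive does not increase.  The
    exceptional null set lies in an open set [U] of small measure; every point
    of [0, 1] has a neighbourhood in which intervals around it either lie in
    [U] or carry an increment at most [e] times their length; so [0, 1] is a
    chain of such intervals.  The intervals of the second kind contribute at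
    most [e] in total, and those inside [U] contribute little by absolute
    continuity. *)

(** * Real functions on the unit interval *)

Section realfun.
Context {R : realType}.
Implicit Types (f g h : R -> R) (t : R).

(** Compactness of [0, 1] as an induction principle: the supremum of the points
    reached is itself reached from its left, and then passed unless it is 1. *)
Lemma unit_interval_induction (P : R -> Prop) :
  P 0 ->
  (forall t, 0 <= t <= 1 -> exists2 d, 0 < d &
     forall a b, 0 <= a -> b <= 1 -> t - d < a -> a <= t -> t <= b ->
       b < t + d -> P a -> P b) ->
  P 1.
Proof.
move=> P0 Pstep; pose E : set R := [set s | 0 <= s <= 1 /\ P s].
have E0 : E 0 by split=> //; rewrite lexx ler01.
have ubE : has_ubound E by exists 1 => s [/andP[]].
have c01 : 0 <= sup E <= 1.
  rewrite (ub_le_sup ubE E0) /=; apply: ge_sup; first by exists 0.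
  by move=> s [/andP[]].
have [d d0 step] := Pstep _ c01.
have [a [/andP[a0 a1] Pa] ltca] := sup_adherent d0 (conj (ex_intro _ _ E0) ubE).
have leac : a <= sup E by apply: ub_le_sup => //; split=> //; rewrite a0.
have [c1|c1] := leP 1 (sup E + d / 2).
  by apply: (step a 1) => //; lra.
have Pb : P (sup E + d / 2) by apply: (step a) => //; lra.
have Eb : E (sup E + d / 2) by split=> //; lra.
have := ub_le_sup ubE Eb; lra.
Qed.

(** The scalar counterpart of [abs_cont]: the pairing of two vector functions is
    not itself vector-valued, and its summands are products of coordinates. *)
Definition abs_contR f : Prop :=
  forall e : R, 0 < e -> exists2 d : R, 0 < d &
    forall (m : nat) (l r : 'I_m -> R),
      (forall i, 0 <= l i /\ l i <= r i /\ r i <= 1) ->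
      trivIset [set: 'I_m] (fun i => `]l i, r i[%classic) ->
      \sum_(i < m) (r i - l i) < d ->
      \sum_(i < m) `|f (r i) - f (l i)| < e.

Lemma abs_contR_unif f e : abs_contR f -> 0 < e ->
  exists2 d, 0 < d & forall a b, 0 <= a -> a <= b -> b <= 1 -> b - a < d ->
    `|f b - f a| < e.
Proof.
move=> acf e0; have [d d0 acd] := acf e e0; exists d => // a b a0 ab b1 bad.
have := acd 1%N (fun=> a) (fun=> b); rewrite !big_ord1; apply=> //.
by move=> i j _ _ _; rewrite [i]ord1 [j]ord1.
Qed.

Lemma abs_contR_bounded f : abs_contR f ->
  exists2 M, 0 < M & forall t, 0 <= t <= 1 -> `|f t| <= M.
Proof.
move=> acf; have [d d0 fd] := abs_contR_unif acf ltr01.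
pose P s := 0 <= s /\
  exists2 M, 0 < M & forall t, 0 <= t <= s -> `|f t| <= M.
suff [_ //] : P 1.
apply: unit_interval_induction.
  split=> //; exists (`|f 0| + 1); first by have := normr_ge0 (f 0); lra.
  by move=> t; rewrite -eq_le => /eqP <-; lra.
move=> t t01; exists (d / 2); first by lra.
move=> a b a0 b1 ta le_at le_tb bt [_ [M M0 fM]]; split; first by lra.
exists (M + 1); first by lra.
move=> u /andP[u0 ub]; have [ua|au] := leP u a.
  by have := fM u; rewrite u0 ua => /(_ isT); lra.
have fa : `|f a| <= M by apply: fM; rewrite a0 lexx.
have fu : `|f u - f a| < 1 by apply: fd; lra.
have := ler_normD (f u - f a) (f a); rewrite subrK; lra.
Qed.

Lemma abs_contR0 : abs_contR (fun=> 0).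
Proof.
move=> e e0; exists 1 => // m l r _ _ _; rewrite big1 // => i _.
by rewrite subrr normr0.
Qed.

Lemma abs_contRD f g : abs_contR f -> abs_contR g ->
  abs_contR (fun t => f t + g t).
Proof.
move=> acf acg e e0; have e20 : 0 < e / 2 by lra.
have [d1 d10 fd] := acf _ e20; have [d2 d20 gd] := acg _ e20.
exists (Num.min d1 d2); first by rewrite lt_min d10.
move=> m l r lr tI; rewrite lt_min => /andP[/(fd m l r lr tI) fe].
move=> /(gd m l r lr tI) ge.
apply: (@le_lt_trans _ _ (\sum_(i < m) `|f (r i) - f (l i)| +
                          \sum_(i < m) `|g (r i) - g (l i)|)); last by lra.
rewrite -big_split /=; apply: ler_sum => i _.
by rewrite opprD addrACA; exact: ler_normD.
Qed.

Lemma abs_contR_sum (I : Type) (r : seq I) (f : I -> R -> R) :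
  (forall i, abs_contR (f i)) -> abs_contR (fun t => \sum_(i <- r) f i t).
Proof.
move=> acf; elim: r => [|i r IHr].
  by under [X in abs_contR X]funext do rewrite big_nil; exact: abs_contR0.
under [X in abs_contR X]funext do rewrite big_cons.
exact: (abs_contRD (acf i) IHr).
Qed.

Lemma abs_contRB f g : abs_contR f -> abs_contR g ->
  abs_contR (fun t => f t - g t).
Proof.
move=> acf acg; apply: (abs_contRD acf) => e e0.
have [d d0 gd] := acg _ e0; exists d => // m l r lr tI lrd.
apply: le_lt_trans (gd m l r lr tI lrd); apply: ler_sum => i _.
by rewrite -opprD normrN.
Qed.

(** The increment of a product is controlled by those of the factors because an
    absolutely continuous function on [0, 1] is bounded. *)
Lemma abs_contRM f g : abs_contR f -> abs_contR g ->
  abs_contR (fun t => f t * g t).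
Proof.
move=> acf acg e e0.
have [M M0 fM] := abs_contR_bounded acf.
have [L L0 gL] := abs_contR_bounded acg.
have eL : 0 < e / 2 / L by rewrite !divr_gt0.
have eM : 0 < e / 2 / M by rewrite !divr_gt0.
have [d1 d10 fd] := acf _ eL; have [d2 d20 gd] := acg _ eM.
exists (Num.min d1 d2); first by rewrite lt_min d10.
move=> m l r lr tI; rewrite lt_min => /andP[/(fd m l r lr tI) fe].
move=> /(gd m l r lr tI) ge; move: fe ge; rewrite !ltr_pdivlMr // => fe ge.
apply: (@le_lt_trans _ _ (\sum_(i < m) (`|f (r i) - f (l i)| * L +
                          `|g (r i) - g (l i)| * M))); last first.
  by rewrite big_split -!mulr_suml /=; lra.
apply: ler_sum => i _; have [l0 [le_lr r1]] := lr i.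
have -> : f (r i) * g (r i) - f (l i) * g (l i) =
  (f (r i) - f (l i)) * g (r i) + (g (r i) - g (l i)) * f (l i) by lra.
apply: (le_trans (ler_normD _ _)); rewrite !normrM.
by apply: lerD; apply: ler_wpM2l => //; [apply: gL|apply: fM]; lra.
Qed.

(** Derivative relative to [0, 1], as a relation: derivatives that exist only
    almost everywhere can then be combined without mentioning default values. *)
Definition derivR f t (l : R) : Prop :=
  (s - t)^-1 * (f s - f t) @[s --> within `[0, 1] t^'] --> l.

Lemma derivR_cvg f t l : derivR f t l ->
  f s @[s --> within `[0, 1] t^'] --> (f t : R).
Proof.
move=> fl.
have idt : s - t @[s --> within `[0, 1] t^'] --> (0:R).
  rewrite -[X in _ --> X](subrr t); apply: cvgB; last exact: cvg_cst.
  by apply: cvg_within_filter; apply: cvg_within.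
have : f t + (s - t) * ((s - t)^-1 * (f s - f t))
    @[s --> within `[0, 1] t^'] --> (f t + 0 * l : R).
  by apply: cvgD; [exact: cvg_cst|apply: cvgM].
rewrite mul0r addr0; apply: cvg_trans; apply: near_eq_cvg.
have neqt : \forall s \near within `[0, 1] t^', s != t.
  by rewrite near_withinE; apply: filterS (nbhs_dnbhs_neq t).
by apply: filterS neqt => s st; rewrite mulVKf ?subrKC // subr_eq0.
Qed.

Lemma derivR0 t : derivR (fun=> 0) t 0.
Proof.
rewrite /derivR; under eq_cvg do rewrite subrr mulr0.
exact: cvg_cst.
Qed.

Lemma derivRD f g t k l : derivR f t k -> derivR g t l ->
  derivR (fun t => f t + g t) t (k + l).
Proof.
move=> fk gl; apply: (cvg_trans _ (cvgD fk gl)); apply: near_eq_cvg.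
apply: nearW => s /=.
by rewrite -mulrDr opprD addrACA.
Qed.

Lemma derivR_sum (I : Type) (r : seq I) (f : I -> R -> R) (l : I -> R) t :
  (forall i, derivR (f i) t (l i)) ->
  derivR (fun t => \sum_(i <- r) f i t) t (\sum_(i <- r) l i).
Proof.
move=> fl; elim: r => [|i r IHr].
  rewrite big_nil; under [X in derivR X]funext do rewrite big_nil.
  exact: derivR0.
rewrite big_cons; under [X in derivR X]funext do rewrite big_cons.
exact: derivRD.
Qed.

Lemma derivRB f g t k l : derivR f t k -> derivR g t l ->
  derivR (fun t => f t - g t) t (k - l).
Proof.
move=> fk gl; apply: (cvg_trans _ (cvgB fk gl)); apply: near_eq_cvg.
by apply: nearW => s /=; rewrite !fctE -mulrBr; congr (_ * _); ring.
Qed.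

Lemma derivRM f g t k l : derivR f t k -> derivR g t l ->
  derivR (fun t => f t * g t) t (k * g t + f t * l).
Proof.
move=> fk gl.
apply: (cvg_trans _ (cvgD (cvgM fk (derivR_cvg gl))
                          (cvgM (cvg_cst (f t)) gl))).
apply: near_eq_cvg; apply: nearW => s /=; rewrite fctE /=; ring.
Qed.

Local Notation mu := (@lebesgue_measure R).

(** * Absolutely continuous functions with a nonpositive derivative *)

Lemma null_set_open_cover (N : set R) (e : R) :
  mu.-negligible N -> 0 < e ->
  exists U : set R, [/\ open U, N `<=` U & (mu U < e%:E)%E].
Proof.
move=> [A [mA A0 NA]] e0.
have {}A0 : mu A = 0%E := A0.
have Afin : (mu A < +oo)%E by rewrite A0 ltry.
have [U [oU AU Ue]] := lebesgue_regularity_outer mA Afin e0.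
exists U; split=> //; first exact: subset_trans AU.
apply: le_lt_trans Ue.
have mU : measurable U by exact: measurable_realfun.open_measurable.
rewrite -{1}(setDUK AU); apply: (le_trans (measureU2 _ _ _)) => //.
  exact: measurableD.
by have : (mu A + mu (U `\` A) <= mu (U `\` A))%E by rewrite A0 add0e.
Qed.

Lemma sum_itv_lengths_le (m : nat) (l r : 'I_m -> R) (U : set R) :
  measurable U -> (forall i, l i <= r i) ->
  trivIset [set: 'I_m] (fun i => `]l i, r i[%classic) ->
  (forall i, `]l i, r i[ `<=` U) ->
  ((\sum_(i < m) (r i - l i))%:E <= mu U)%E.
Proof.
move=> mU lr tI sU.
have mI (i : 'I_m) : measurable (`]l i, r i[%classic : set R) by [].
have len_le i : ((r i - l i)%:E <= mu `]l i, r i[)%E.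
  rewrite lebesgue_measure_itv /= lte_fin; case: ltP => [_|rl].
    by rewrite EFinB.
  by rewrite lee_fin subr_le0.
have mbig : measurable (\big[setU/set0]_(i < m) (`]l i, r i[%classic : set R)).
  by apply: bigsetU_measurable.
apply: (@le_trans _ _ (mu (\big[setU/set0]_(i < m) `]l i, r i[%classic))).
  rewrite measure_semi_additive_ord // -sumEFin.
  by apply: lee_sum => i _; exact: len_le.
apply: le_measure; rewrite ?inE //.
by apply: (big_ind (fun X => X `<=` U)) => // X Y XU YU; rewrite subUset.
Qed.

(** The slope bound straddles [t]: [f b - f a] splits at [t], and the difference
    quotient at [t] bounds each half. *)
Lemma derivR_le_near f t l e : derivR f t l -> l < e ->
  exists2 d, 0 < d & forall a b, 0 <= a -> b <= 1 -> t - d < a -> a <= t ->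
    t <= b -> b < t + d -> f b - f a <= e * (b - a).
Proof.
move=> fl le; have : \forall s \near within `[0, 1] t^',
    (s - t)^-1 * (f s - f t) < e by exact: cvgr_lt fl _ le.
rewrite near_withinE near_withinE => /nbhs_ballP[d /= d0 fd].
exists d => // a b a0 b1 tda at_ tb btd.
have fdE u : `|t - u| < d -> u != t -> 0 <= u <= 1 ->
    (u - t)^-1 * (f u - f t) < e.
  by move=> tud ut u01; apply: fd => //=; rewrite in_itv.
have fb : f b - f t <= e * (b - t).
  have [->|bt] := eqVneq b t; first by rewrite !subrr mulr0.
  have t_lt_b : t < b by rewrite lt_neqAle eq_sym bt.
  apply: ltW; rewrite mulrC -ltr_pdivrMl ?subr_gt0 //.
  apply: fdE => //; last lra.
  by rewrite ltr_norml; lra.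
have fa : f t - f a <= e * (t - a).
  have [->|ne_at] := eqVneq a t; first by rewrite !subrr mulr0.
  have a_lt_t : a < t by rewrite lt_neqAle ne_at.
  have : (a - t) * e < f a - f t.
    rewrite -ltr_ndivrMl ?subr_lt0 //; apply: fdE => //; last lra.
    by rewrite ltr_norml; lra.
  lra.
lra.
Qed.

(** The exceptional points are absorbed in a small open set, on which absolute
    continuity controls the increments; elsewhere the derivative does. *)
Lemma abs_contR_nonincreasing h : abs_contR h ->
  (\forall t \ae mu, t \in `[0, 1] -> exists2 l, derivR h t l & l <= 0) ->
  h 1 <= h 0.
Proof.
move=> ach dh; apply/ler_addgt0Pr => e e0; have e20 : 0 < e / 2 by lra.
have [d d0 hd] := ach _ e20.
have [U [oU NU mUd]] := null_set_open_cover dh d0.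
(* A chain is an infinite sequence that becomes constant, so that extending it
   changes no index type; the repeated end points are harmless because
   degenerate intervals are good. *)
pose good a b := h b - h a <= e / 2 * (b - a) \/ `]a, b[ `<=` U.
pose chain s := exists p : nat -> R, [/\ p 0%N = 0,
  forall i, p i <= p i.+1, forall i, good (p i) (p i.+1) &
  exists m, forall i, (m <= i)%N -> p i = s].
have good_refl a : good a a by left; rewrite !subrr mulr0.
have : chain 1.
  apply: unit_interval_induction.
    by exists (fun=> 0); split=> //; exists 0%N.
  move=> t t01.
  (* g is the gauge at t: intervals around t that are finer than g are good *)
  have [g g0 goodt] : exists2 g, 0 < g & forall a b, 0 <= a -> b <= 1 ->
      t - g < a -> a <= t -> t <= b -> b < t + g -> good a b.
    have [Ut|nUt] := pselect (U t).
      have /nbhs_ballP[g /= g0 gU] : nbhs t U by exact: open_nbhs_nbhs.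
      exists g => // a b _ _ tga at_ tb btg; right=> u /=.
      rewrite in_itv /= => /andP[au ub]; apply: gU.
      by rewrite /ball /= ltr_norml; lra.
    have [l hl l0] : exists2 l, derivR h t l & l <= 0.
      apply: contrapT => nd; apply: nUt; apply: NU => /= dt; apply: nd.
      by apply: dt; rewrite in_itv.
    have [g g0 hg] := derivR_le_near hl (le_lt_trans l0 e20).
    by exists g => // a b *; left; exact: hg.
  exists g => // a b a0 b1 tga at_ tb btg [p [p0 pS pg [m pm]]].
  exists (fun i => if (i <= m)%N then p i else b); split=> //=.
  - move=> i; case: (ltngtP i m) => // ->.
    by rewrite pm //; exact: le_trans tb.
  - move=> i; case: (ltngtP i m) => // ->.
    by rewrite pm //; exact: goodt.
  - by exists m.+1 => i mi; rewrite leqNgt mi.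
move=> [p [p0 pS pg [m pm]]].
have ple : {homo p : i j / (i <= j)%N >-> i <= j}.
  exact: homo_leq le_trans pS.
have p_ge0 i : 0 <= p i by rewrite -p0 ple.
have p_le1 i : p i <= 1 by rewrite -(pm (maxn m i)) ?leq_maxl // ple ?leq_maxr.
(* Links that do not lie in U are collapsed to a point, so that one family
   indexed by all the links collects the intervals inside U. *)
pose l (i : 'I_m) := p i.
pose r (i : 'I_m) := if `[< `]p i, p i.+1[ `<=` U >] then p i.+1 else p i.
have lr i : l i <= r i <= p i.+1.
  by rewrite /l /r; case: asboolP; rewrite lexx pS.
have lr01 i : 0 <= l i /\ l i <= r i /\ r i <= 1.
  have /andP[lri rip] := lr i; split; first exact: p_ge0.
  by split=> //; exact: le_trans rip _.
have sU i : `]l i, r i[ `<=` U.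
  by rewrite /l /r; case: asboolP => // _ u /=; rewrite in_itv /=; lra.
have tI : trivIset [set: 'I_m] (fun i => `]l i, r i[%classic).
  apply/trivIsetP => i j _ _ ij.
  wlog : i j ij / (i < j)%N => [H|].
    have := ij; rewrite -val_eqE neq_ltn => /orP[/H->//|/H].
    by rewrite setIC; apply; rewrite eq_sym.
  move=> ltij; apply/seteqP; split=> // u [] /=; rewrite !in_itv /=.
  move=> /andP[_ ur] /andP[lu _]; have /andP[_ rip] := lr i.
  have : p i.+1 <= l j by exact: ple.
  lra.
have sum_lt : \sum_(i < m) (r i - l i) < d.
  rewrite -lte_fin; apply: le_lt_trans mUd; apply: sum_itv_lengths_le => //.
  - exact: measurable_realfun.open_measurable.
  - by move=> i; have /andP[] := lr i.
have := hd m l r lr01 tI sum_lt.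
have : h 1 - h 0 <= \sum_(i < m) (e / 2 * (p i.+1 - p i)) +
                    \sum_(i < m) `|h (r i) - h (l i)|.
  have -> : h 1 - h 0 = \sum_(i < m) (h (p i.+1) - h (p i)).
    have := telescope_sumr (h \o p) (leq0n m).
    by rewrite big_mkord /= p0 pm.
  rewrite -big_split /=; apply: ler_sum => i _; rewrite /r /l.
  case: asboolP => [_|nU]; last first.
    by rewrite subrr normr0 addr0; have [|/nU] := pg i.
  by apply: ler_wpDl; [rewrite mulr_ge0 ?subr_ge0 // ltW|exact: ler_norm].
rewrite -mulr_sumr -(big_mkord xpredT (fun i => p i.+1 - p i)).
rewrite telescope_sumr // pm // p0; lra.
Qed.

End realfun.

(** * Vector functions and the duality pairing *)

Section vectors.
Context {R : realType} {n : nat}.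
Implicit Types f : R -> 'rV[R]_n.

Lemma abs_cont_coord f i : abs_cont f -> abs_contR (fun t => f t ord0 i).
Proof.
move=> acf e e0; have [d d0 fd] := acf e e0; exists d => // m l r lr tI lrd.
apply: le_lt_trans (fd m l r lr tI lrd); apply: ler_sum => k _.
set v := f (r k) - f (l k).
have -> : f (r k) ord0 i - f (l k) ord0 i = v ord0 i by rewrite !mxE.
rewrite [leRHS]mx_normrE.
exact: (le_bigmax _ (fun ij => `|v ij.1 ij.2|) (ord0, i)).
Qed.

Lemma diff_quot_coord f t i : cvg (diff_quot f t) ->
  derivR (fun t => f t ord0 i) t (der f t ord0 i).
Proof.
move=> fl; have := cvg_comp _ _ fl (@coord_continuous _ _ _ ord0 i _).
apply: cvg_trans; apply: near_eq_cvg; apply: nearW => s /=; by rewrite !mxE.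
Qed.

Lemma dotC (u v : 'rV[R]_n) : dot u v = dot v u.
Proof. by rewrite /dot; apply: eq_bigr => i _; rewrite mulrC. Qed.

Lemma dotNl (u v : 'rV[R]_n) : dot (- u) v = - dot u v.
Proof. by rewrite /dot -sumrN; apply: eq_bigr => i _; rewrite mxE mulNr. Qed.

(** In a convex set [w - w0] is tangent at [w0] with zero remainder, since the
    whole segment from [w0] to [w] stays in the set. *)
Lemma dual_cone_convex (A : set 'rV[R]_n) w0 w ws : convex_set A ->
  A w0 -> A w -> dual_cone A w0 ws -> 0 <= dot ws (w - w0).
Proof.
move=> cA Aw0 Aw; rewrite dotC; apply; exists (fun=> 0); split; last first.
  by under eq_cvg do rewrite scaler0; exact: cvg_cst.
near=> l; rewrite addr0.
have l0 : 0 <= l by near: l; exact: nbhs_right_ge.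
have l1 : l <= 1 by near: l; exact: nbhs_right_le.
have := cA w w0 (Itv01 l0 l1); rewrite !inE => /(_ Aw Aw0).
by rewrite /conv /= /unstable.onem scalerBl scale1r addrCA -scalerBr.
Unshelve. all: by end_near. Qed.

Lemma dotBl (u v w : 'rV[R]_n) : dot (u - v) w = dot u w - dot v w.
Proof. by rewrite /dot -sumrB; apply: eq_bigr => i _; rewrite !mxE mulrBl. Qed.

End vectors.

(** * The sufficient condition *)

(** Comparing [z1] with the Hamiltonian at [(x1, y1)], and the maximiser [z]
    with the one at [(x, y)], turns the subgradient-type inequality for the
    Hamiltonian into one between real numbers. *)
Lemma adjoint_inequality (R : realType) (n : nat)
    (G : 'rV[R]_n -> 'rV[R]_n -> set 'rV[R]_n)
    (zs x y z p q x1 y1 z1 : 'rV[R]_n) :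
  argmax G x y zs z -> locally_adjoint G zs (x, y, z) (p, q) -> G x1 y1 z1 ->
  dot (z1 - z) zs <= dot p (x1 - x) + dot q (y1 - y).
Proof.
move=> [_ Hz] adj Gz1; have := adj x1 y1; rewrite /= -Hz => adj1.
have Hz1 : ((dot z1 zs)%:E <= hamiltonian G x1 y1 zs)%E.
  by apply: ereal_sup_ubound; exists z1.
rewrite dotBl -lee_fin EFinB; apply: le_trans adj1; exact: leeB.
Qed.

(** The product rule for [<s, y' - x'> - <v + s', y - x>], coordinate by
    coordinate: the numeral 1 or 2 after a name marks the order of the
    derivative.  The two terms [<s', y' - x'>] cancel. *)
Lemma sum_pairing_deriv (R : realType) (n : nat)
    (x y s v x1 y1 s1 v1 x2 y2 s2 : 'rV[R]_n) :
  \sum_(i < n)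
    (s1 ord0 i * (y1 ord0 i - x1 ord0 i) + s ord0 i * (y2 ord0 i - x2 ord0 i) -
     ((v1 ord0 i + s2 ord0 i) * (y ord0 i - x ord0 i) +
      (v ord0 i + s1 ord0 i) * (y1 ord0 i - x1 ord0 i))) =
  dot (y2 - x2) s - (dot (s2 + v1) (y - x) + dot v (y1 - x1)).
Proof.
rewrite /dot -big_split -sumrB /=; apply: eq_bigr => i _; rewrite !mxE; ring.
Qed.

(** The hypothesis says, by [sum_pairing_deriv], that the derivative of the
    difference of pairings is nonnegative almost everywhere. *)
Lemma pairing_nondecreasing (R : realType) (n : nat)
    (x y xs vs : R -> 'rV[R]_n) :
  AC2_L1 x -> AC2_L1 y -> AC2_L1 xs -> AC_L1 vs ->
  (\forall t \ae @lebesgue_measure R, t \in `[0, 1] ->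
    dot (der (der y) t - der (der x) t) (xs t) <=
    dot (der (der xs) t + der vs t) (y t - x t) +
    dot (vs t) (der y t - der x t)) ->
  dot (vs 0 + der xs 0) (y 0 - x 0) - dot (xs 0) (der y 0 - der x 0) <=
  dot (vs 1 + der xs 1) (y 1 - x 1) - dot (xs 1) (der y 1 - der x 1).
Proof.
move=> [acx dx [acx' [dx' _]]] [acy dy [acy' [dy' _]]].
move=> [acs ds [acs' [ds' _]]] [acv [dv _]] ineq.
(* g is the pairing with the opposite sign, expanded so that the rules for
   scalar functions apply to each summand. *)
pose g t := \sum_(i < n)
  (xs t ord0 i * (der y t ord0 i - der x t ord0 i) -
   (vs t ord0 i + der xs t ord0 i) * (y t ord0 i - x t ord0 i)).
have gE t : g t = - (dot (vs t + der xs t) (y t - x t) -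
                    dot (xs t) (der y t - der x t)).
  by rewrite opprB /dot -sumrB; apply: eq_bigr => i _; rewrite !mxE.
suff : g 1 <= g 0 by rewrite !gE lerN2.
apply: abs_contR_nonincreasing.
  apply: abs_contR_sum => i.
  have ac f := @abs_cont_coord R n f i.
  have ac_d := abs_contRB (ac _ acy) (ac _ acx).
  have ac_d' := abs_contRB (ac _ acy') (ac _ acx').
  have ac_p := abs_contRD (ac _ acv) (ac _ acs').
  exact: abs_contRB (abs_contRM (ac _ acs) ac_d') (abs_contRM ac_p ac_d).
have aeF : @Filter R (nbhs (almost_everywhere (@lebesgue_measure R))).
  exact: (ae_filter_ringOfSetsType (@lebesgue_measure R)).
have dxy := @filterI _ _ aeF _ _ dx' dy'.
have dsv := @filterI _ _ aeF _ _ ds' dv.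
apply: (@filterS3 _ _ aeF _ _ _ _ _ dxy dsv ineq).
move=> t [{}dx' {}dy'] [{}ds' {}dv] {}ineq t01.
exists (dot (der (der y) t - der (der x) t) (xs t) -
        (dot (der (der xs) t + der vs t) (y t - x t) +
         dot (vs t) (der y t - der x t))); last first.
  by rewrite subr_le0; exact: ineq.
rewrite -(sum_pairing_deriv _ _ _ _ _ _ (der xs t)).
apply: derivR_sum => i.
have D f := @diff_quot_coord R n f t i.
have D_d := derivRB (D _ (dy t t01)) (D _ (dx t t01)).
have D_d' := derivRB (D _ (dy' t01)) (D _ (dx' t01)).
have D_p := derivRD (D _ (dv t01)) (D _ (ds' t01)).
exact: derivRB (derivRM (D _ (ds t t01)) D_d') (derivRM D_p D_d).
Qed.

Theorem theorem5p1 (R : realType) (n : nat)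
    (phi : 'rV[R]_n * 'rV[R]_n -> R)
    (F : R -> 'rV[R]_n -> 'rV[R]_n -> set 'rV[R]_n)
    (Q0 Q1 : set 'rV[R]_n)
    (phi_continuous : continuous phi)
    (phi_convex : @convex_function R ('rV[R]_n * 'rV[R]_n)%type setT phi)
    (F_convex : forall t, t \in `[0, 1] -> convex_map (F t))
    (Q0_nonempty : Q0 !=set0) (Q0_convex : convex_set Q0)
    (Q1_nonempty : Q1 !=set0) (Q1_convex : convex_set Q1)
    (xt : R -> 'rV[R]_n) (xt_feasible : feasible F Q0 Q1 xt) :
  (exists xs vs : R -> 'rV[R]_n,
    AC2_L1 xs /\
    AC_L1 vs /\
    (\forall t \ae @lebesgue_measure R, t \in `[0, 1] ->
       locally_adjoint (F t) (xs t) (xt t, der xt t, der (der xt) t)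
         (der (der xs) t + der vs t, vs t)) /\
    (\forall t \ae @lebesgue_measure R, t \in `[0, 1] ->
       argmax (F t) (xt t) (der xt t) (xs t) (der (der xt) t)) /\
    (dual_cone Q0 (xt 0) `*` dual_cone Q1 (der xt 0))
      (vs 0 + der xs 0, - xs 0) /\
    subdifferential phi (xt 1, der xt 1) (vs 1 + der xs 1, - xs 1)) ->
  optimal phi F Q0 Q1 xt.

Proof.
move=> [xs [vs [ac_xs [ac_vs [adj [am [[cone0 cone1] sub]]]]]]].
split=> // y y_feasible.
have [acx Fx Q0x Q1x] := xt_feasible; have [acy Fy Q0y Q1y] := y_feasible.
have aeF : @Filter R (nbhs (almost_everywhere (@lebesgue_measure R))).
  exact: (ae_filter_ringOfSetsType (@lebesgue_measure R)).
have le_h := pairing_nondecreasing acx acy ac_xs ac_vs.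
have {}le_h := le_h (@filterS3 _ _ aeF _ _ _ _
  (fun t adj am Fy t01 => adjoint_inequality (am t01) (adj t01) (Fy t01))
  adj am Fy).
have c0 := dual_cone_convex Q0_convex Q0x Q0y cone0.
have := dual_cone_convex Q1_convex Q1x Q1y cone1; rewrite dotNl oppr_ge0 => c1.
have := sub (y 1, der y 1); rewrite /= dotNl => h1.
rewrite -subr_ge0; apply: le_trans h1; apply: le_trans le_h.
by rewrite subr_ge0; exact: le_trans c0.
Qed.
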